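(* Let $n\ge3$. For $j\in\{-2,-1,0,1\}$ and $i,k\in\{0,\dots,n\}$ let $$(\tilde C_j(n))_{i,k}=\int_{-\infty}^{\infty}\tilde\phi_i(t)\,\tilde\phi_k(2t-j)\,dt,\qquad (C_j(n))_{i,k}=\frac{(\tilde C_j(n))_{i,k}}{\int_{-\infty}^\infty \tilde\phi_k(2t)^2\,dt}.$$ Then $$(C_{-2}(n))_{i,k}=\begin{cases}0, & i=0,\dots,n,\ k=0,\\ (-1)^{n+1}(C_1(n))_{i,k}, & i=0,\ k=1,\\ (-1)^k(C_1(n))_{i,k}, & i=0,\ k=2,\dots,n,\\ 0, & i=1,\dots,n,\ k=1,\dots,n,\end{cases}$$ $$(C_{-1}(n))_{i,k}=\begin{cases}(C_1(n))_{i,k}, & i=0,\ k=0,\\ (-1)^{n+1}(C_0(n))_{i,k}, & i=0,\ k=1,\\ (-1)^k(C_0(n))_{i,k}, & i=0,\ k=2,\dots,n,\\ 0, & i=1,\dots,n,\ k=0,\dots,n,\end{cases}$$ $$(C_0(n))_{i,k}=0,\qquad i=1,\dots,n,\ k=0,$$ $$(C_1(n))_{i,k}=\begin{cases}(C_0(n))_{i,k}, & i=1,\ k=1,\\ (-1)^{k+n+1}(C_0(n))_{i,k}, & i=1,\ k=2,\dots,n,\\ (-1)^{i+n+1}(C_0(n))_{i,k}, & i=2,\dots,n,\ k=1,\\ (-1)^{i+k}(C_0(n))_{i,k}, & i=2,\dots,n,\ k=2,\dots,n.\end{cases}$$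
   Context: $\langle f,g\rangle=\int_{-1}^1 fg$. $p_n^\lambda$ is the monic ultraspherical polynomial of degree $n$, orthogonal on $[-1,1]$ with respect to $(1-x^2)^{\lambda-1/2}$; for $j\ge2$, $\phi^0_j(t)=(1-t^2)\,p_{j-2}^{5/2}(t)$. For $N\ge2$, $P^N$ is the orthogonal projection of $L^2[-1,1]$ onto the polynomials of degree at most $N$ vanishing at $\pm1$; $r_0^N=(I-P^N)(1+t)$. On $[-1,1]$ let $\bar u_M(t)=1-|t|t^{M-1}$ for odd $M\ge1$, $\bar u_M(t)=t-|t|t^{M-1}$ for even $M\ge2$, and $u_{N,N-M}=(I-P^N)\bar u_M$. For $n\ge3$ let $w_n=\alpha(n)u_{n,0}+u_{n,2}$ with $$\alpha(n)=\frac{2}{n(2n-1)}\left(\frac{(n-2)(2n+1)}{n-1}-2\sqrt3\,\sqrt{\frac{(2n+1)(n+1)}{(2n-3)(n-1)}}\right),$$ and $q_{r_0^n}=r_0^n-\frac{\langle w_n,r_0^n\rangle}{\langle w_n,w_n\rangle}w_n$, $q_{l_0^n}(t)=q_{r_0^n}(-t)$. The functions $\tilde\phi_0,\dots,\tilde\phi_n$ on $\mathbf R$ are: - $\tilde\phi_0(t)=q_{r_0^n}(2t+1)$ for $-1\le t<0$, $q_{l_0^n}(2t-1)$ for $0\le t<1$, $0$ elsewhere; - $\tilde\phi_1(t)=w_n(2t-1)$ for $0\le t<1$, $0$ elsewhere; - for $j=2,\dots,n$: $\tilde\phi_j(t)=\phi^0_j(2t-1)$ for $0\le t<1$, $0$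 elsewhere. The vector $\Phi_n=(\tilde\phi_0,\dots,\tilde\phi_n)^T$ generates an orthogonal multiresolution analysis: with $V_0$ the closed $L^2(\mathbf R)$-span of the integer translates of the $\tilde\phi_i$ and $V_p=\{f(2^p\cdot):f\in V_0\}$, one has $V_p\subset V_{p+1}$ and the integer translates of the $\tilde\phi_i$ form an orthogonal basis of $V_0$; moreover $\Phi_n(t)=\sum_{j=-2}^1C_j(n)\Phi_n(2t-j)$, where the $(n+1)\times(n+1)$ matrices $C_j(n)$ have rows and columns indexed by $0,\dots,n$. *)

(* Defs.v *)
From HB Require Import structures.
From mathcomp Require Import all_boot all_order all_algebra.
From mathcomp Require Import all_classical all_reals all_analysis.

Set Implicit Arguments.
Unset Strict Implicit.
Unset Printing Implicit Defensive.

Import Order.TTheory GRing.Theory Num.Theory.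
Import numFieldNormedType.Exports.

Local Open Scope classical_set_scope.
Local Open Scope ring_scope.

Section Defs.
Variable R : realType.
Implicit Types (N M k n : nat) (f g : R -> R) (p q : {poly R}) (t : R).

Definition inner f g : R :=
  \int[lebesgue_measure]_(t in `[-1, 1]) (f t * g t).

(* The degree is size - 1. *)
Definition is_ultraspherical (lambda : R) n p : Prop :=
  [/\ p \is monic, size p = n.+1 &
      forall q, (size q <= n)%N ->
        \int[lebesgue_measure]_(t in `[-1, 1])
          (p.[t] * q.[t] * ((1 - t ^+ 2) `^ (lambda - 1 / 2))) = 0].

(* For lambda > -1/2 there is exactly one such polynomial; the default value 0
   of xget is then irrelevant. *)
Definition ultraspherical (lambda : R) n : {poly R} :=
  xget 0 [set p | is_ultraspherical lambda n p].

Definition phi0 (j : nat) t : R :=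
  (1 - t ^+ 2) * (ultraspherical (5 / 2) (j - 2)).[t].

Definition vanishing_poly N : set {poly R} :=
  [set p : {poly R} | [/\ (size p <= N.+1)%N, p.[-1] = 0 & p.[1] = 0]].

Definition is_proj N f p : Prop :=
  vanishing_poly N p /\
  forall q, vanishing_poly N q -> inner (fun t => f t - p.[t]) (horner q) = 0.

(* P^N f; for f square integrable on [-1, 1] exactly one p satisfies
   is_proj N f p, since the vanishing_poly N form a finite-dimensional space. *)
Definition proj N f : {poly R} := xget 0 [set p | is_proj N f p].

(* (I - P^N) f; as an element of L^2[-1, 1], only its values there matter. *)
Definition resid N f t : R := f t - (proj N f).[t].

Definition r0 N : R -> R := resid N (fun t => 1 + t).

Definition ubar M t : R :=
  if odd M then 1 - `|t| * t ^+ M.-1 else t - `|t| * t ^+ M.-1.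

(* u_{N,k} with k = N - M. *)
Definition u N k : R -> R := resid N (ubar (N - k)).

Definition alpha n : R :=
  let x : R := n%:R in
  2 / (x * (2 * x - 1)) *
  ((x - 2) * (2 * x + 1) / (x - 1)
   - 2 * Num.sqrt 3
       * Num.sqrt (((2 * x + 1) * (x + 1)) / ((2 * x - 3) * (x - 1)))).

Definition w n t : R := alpha n * u n 0 t + u n 2 t.

Definition q_r n t : R := r0 n t - inner (w n) (r0 n) / inner (w n) (w n) * w n t.

Definition q_l n t : R := q_r n (- t).

Definition phit n (j : nat) t : R :=
  match j with
  | 0 => if (-1 <= t) && (t < 0) then q_r n (2 * t + 1)
         else if (0 <= t) && (t < 1) then q_l n (2 * t - 1) else 0
  | 1 => if (0 <= t) && (t < 1) then w n (2 * t - 1) else 0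
  | _ => if (0 <= t) && (t < 1) then phi0 j (2 * t - 1) else 0
  end.

Definition Ctilde n (j : int) : 'M[R]_n.+1 :=
  \matrix_(i < n.+1, k < n.+1)
    \int[lebesgue_measure]_t (phit n i t * phit n k (2 * t - j%:~R)).

Definition Cmat n (j : int) : 'M[R]_n.+1 :=
  \matrix_(i < n.+1, k < n.+1)
    (Ctilde n j i k / \int[lebesgue_measure]_t (phit n k (2 * t) ^+ 2)).

End Defs.

(* Main.v *)
Require Import Defs.
From HB Require Import structures.
From mathcomp Require Import all_boot all_order all_algebra.
From mathcomp Require Import all_classical all_reals all_analysis.
From mathcomp Require Import measurable_realfun zify ring lra.

(* The claimed relations come from two symmetries: phit_0 is even, and for
   k >= 1 the restriction of phit_k to [0, 1] is even or odd about 1/2.  The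
   entries that vanish for another reason than disjoint supports reduce to
   <q_l, p> = 0 for all polynomials p of degree at most n with p(-1) = 0.
   Such a p is seen by the residuals (I - P^n) f only through p(1), so this is a
   single identity between the Gram matrix of u_{n,0}, u_{n,2} and their pairings
   with r_0: a quadratic equation of which alpha(n) is a root.
   The Gram matrix is found in closed form as follows. On [0, 1], u_{n,n-m} is a
   polynomial q in t^m and the t^c with c in S = {c < n, c = n - 1 mod 2};
   orthogonality says that the moments int_0^1 q t^c, c in S, are all equal, and
   then s |-> int_0^1 q t^s is a rational function with known zeros and poles,
   expressed by Z(s) = prod_{c in S} (s - c) / (s + c + 1). *)

Set Implicit Arguments.
Unset Strict Implicit.
Unset Printing Implicit Defensive.

Import Order.TTheory GRing.Theory Num.Theory.
Import numFieldNormedType.Exports.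
Local Open Scope classical_set_scope.
Local Open Scope ring_scope.

(** * Affine substitutions in Lebesgue integrals *)

Section ChangeOfVariable.
Context {R : realType}.
Notation mu := (@lebesgue_measure R).
Implicit Types f : R -> R.

(** The positive and negative parts are transported separately. If one of them has infinite
    integral, scaling by a positive constant keeps it infinite and [fine] sends both sides to 0. *)
Lemma Rintegral_pushforward_scale (phi : measurableTypeR R -> measurableTypeR R)
    (c : R) f :
  0 < c -> measurable_fun setT phi -> measurable_fun [set: R] f ->
  (forall A, measurable A -> mu A = (c%:E * mu (phi @^-1` A))%E) ->
  \int[mu]_t f (phi t) = c^-1 * \int[mu]_t f t.
Proof.
move=> c0 mphi mf muE.
have cI0 : 0 < c^-1 by rewrite invr_gt0.
have ge0 (g : R -> \bar R) : measurable_fun [set: R] g ->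
    (forall x, 0 <= g x)%E ->
    (\int[mu]_t g (phi t) = (c^-1)%:E * \int[mu]_t g t)%E.
  move=> mg g0.
  have := @ge0_integral_pushforward _ _ _ _ _ _ mphi mu setT g measurableT mg
    (fun y _ => g0 y).
  rewrite preimage_setT => <-.
  suff -> : (\int[mu]_t g t = c%:E * \int[pushforward mu phi]_t g t)%E.
    by rewrite muleA -EFinM mulVf ?gt_eqF// mul1e.
  rewrite -(@ge0_integral_mscale _ _ _ _ _ measurableT (NngNum (ltW c0)))//.
  by apply: eq_measure_integral => //= A mA _; rewrite muE.
have fineMl (x : \bar R) : fine ((c^-1)%:E * x) = c^-1 * fine x.
  case: x => [r| |] //=.
  - by rewrite gt0_muley ?lte_fin//= mulr0.
  - by rewrite gt0_muleNy ?lte_fin//= mulr0.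
have mE : measurable_fun [set: R] (EFin \o f) by exact/measurable_EFinP.
rewrite /Rintegral -fineMl; congr fine.
rewrite integralE [in RHS]integralE.
have -> : (fun x => (f (phi x))%:E)^\+%E = (EFin \o f)^\+%E \o phi.
  by rewrite -funepos_comp.
have -> : (fun x => (f (phi x))%:E)^\-%E = (EFin \o f)^\-%E \o phi.
  by rewrite -funeneg_comp.
rewrite !ge0 //; [|exact: measurable_funeneg|exact: measurable_funepos].
set X := (\int[mu]_t _)%E; set Y := (\int[mu]_t _)%E.
have : (0 <= X)%E by apply: integral_ge0.
have : (0 <= Y)%E by apply: integral_ge0.
case: X => [x| |]; case: Y => [y| |] //= _ _;
  rewrite ?(gt0_muley, gt0_muleNy) ?lte_fin//=.
by rewrite -!(EFinM,EFinB) mulrBr.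
Qed.

Lemma Rintegral_opp f : measurable_fun [set: R] f ->
  \int[mu]_t f (- t) = \int[mu]_t f t.
Proof.
move=> mf; rewrite (@Rintegral_pushforward_scale -%R 1)//.
  by rewrite invr1 mul1r.
by move=> A mA; rewrite mul1e -lebesgue_measureN.
Qed.

(** Uniqueness of Lebesgue measure: [a] times the image of [mu] under the affine map gives half-open
    intervals their length, hence is [mu]. *)
Lemma Rintegral_affine f (a b : R) : 0 < a -> measurable_fun [set: R] f ->
  \int[mu]_t f (a * t + b) = a^-1 * \int[mu]_t f t.
Proof.
move=> a0 mf.
pose phi := (fun t => a * t + b : R) : measurableTypeR R -> measurableTypeR R.
have mphi : measurable_fun setT phi.
  by apply: measurable_funD => //; apply: measurable_funM.
apply: (@Rintegral_pushforward_scale phi) => // A mA.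
transitivity (pushforward (mscale (NngNum (ltW a0)) mu) phi A) => //.
apply: lebesgue_measure_unique => //= _ [[x y]] _ <-.
rewrite /pushforward /mscale /=.
have -> : phi @^-1` `]x, y]%classic = `](x - b) / a, (y - b) / a]%classic.
  apply/seteqP; split => t; rewrite /= !in_itv /= /phi;
    by rewrite ltr_pdivrMr// ler_pdivlMr// ltrBlDr lerBrDr (mulrC a).
rewrite !lebesgue_measure_itv /= !lte_fin ltr_pM2r ?invr_gt0// ltrD2r.
case: ifP => _; last by rewrite mule0.
by rewrite -!EFinD -EFinM; congr EFin; field; rewrite gt_eqF.
Qed.

Lemma Rintegral_onem f : measurable_fun [set: R] f ->
  \int[mu]_t f (1 - t) = \int[mu]_t f t.
Proof.
move=> mf; pose g t := f (1 * t + 1).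
have mg : measurable_fun [set: R] g.
  apply: measurableT_comp => //.
  by apply: measurable_funD => //; apply: measurable_funM.
transitivity (\int[mu]_t g (- t)).
  by apply: eq_Rintegral => t _; rewrite /g mul1r addrC.
by rewrite Rintegral_opp// /g Rintegral_affine// invr1 mul1r.
Qed.

(** Negation swaps the positive and negative parts; infinite integrals become 0 on both sides
    through [fine]. *)
Lemma Rintegral_signr (n : nat) f :
  \int[mu]_t ((-1) ^+ n * f t) = (-1) ^+ n * \int[mu]_t f t.
Proof.
rewrite -signr_odd; case: (odd n); rewrite ?expr0 ?mul1r; last first.
  by apply: eq_Rintegral => t _; rewrite mul1r.
rewrite expr1 mulN1r /Rintegral.
under eq_integral do rewrite mulN1r EFinN.
rewrite integralE [in RHS]integralE funeposN funenegN.
set X := (\int[mu]_t _)%E; set Y := (\int[mu]_t _)%E.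
have : (0 <= X)%E by apply: integral_ge0.
have : (0 <= Y)%E by apply: integral_ge0.
by case: X => [x| |]; case: Y => [y| |] //= _ _; rewrite ?oppr0// opprB.
Qed.

End ChangeOfVariable.

(** * Integrals of continuous functions and polynomials over segments *)

Section SegmentIntegral.
Context {R : realType}.
Notation mu := (@lebesgue_measure R).
Implicit Types (f g : R -> R) (p q : {poly R}).

Lemma continuous_integrable_segment f (a b : R) : continuous f ->
  mu.-integrable `[a, b] (EFin \o f).
Proof.
move=> cf; apply: continuous_compact_integrable; first exact: segment_compact.
exact: continuous_subspaceT.
Qed.

Lemma Rintegral_segmentD f g (a b : R) : continuous f -> continuous g ->
  \int[mu]_(t in `[a, b]) (f t + g t) =
  \int[mu]_(t in `[a, b]) f t + \int[mu]_(t in `[a, b]) g t.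
Proof.
by move=> cf cg; apply: RintegralD => //; exact: continuous_integrable_segment.
Qed.

Lemma Rintegral_segmentZl f (c a b : R) : continuous f ->
  \int[mu]_(t in `[a, b]) (c * f t) = c * \int[mu]_(t in `[a, b]) f t.
Proof.
by move=> cf; apply: RintegralZl => //; exact: continuous_integrable_segment.
Qed.

Lemma Rintegral_symmetric_segment f (a : R) : 0 <= a -> continuous f ->
  \int[mu]_(t in `[- a, a]) f t = \int[mu]_(t in `[0, a]) (f t + f (- t)).
Proof.
move=> a0 cf.
have cfN : continuous (fun t => f (- t)).
  by move=> t; apply: continuous_comp; [exact: opp_continuous|exact: cf].
have ei (x y : R) := @continuous_integrable_segment f x y cf.
rewrite Rintegral_segmentD //.
have /eqP := @Rintegral_itvB R f (BLeft (- a)) (BRight a) 0 (ei _ _)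
  ltac:(by rewrite bnd_simp oppr_le0) ltac:(by rewrite bnd_simp).
rewrite subr_eq => /eqP ->.
congr (_ + _).
  rewrite Rintegral_itv_obnd_cbnd //; apply: integrableS (ei 0 a) => //.
  exact: subset_itv_oc_cc.
rewrite /Rintegral; congr fine.
have := @integration_by_substitution_oppr R f 0 a a0.
by rewrite oppr0 => -> //; exact: continuous_subspaceT.
Qed.

Lemma finite_roots p : p != 0 -> finite_set [set x | root p x].
Proof.
move=> p0; apply: contrapT => /(@infinite_set_fset _ _ (size p))[B Bp].
rewrite leqNgt => /negP; apply.
apply: (max_poly_roots p0); last exact: finmap.fset_uniq.
by apply/allP => x xB; exact: Bp.
Qed.

(** The square vanishes almost everywhere, whereas the roots of a nonzero polynomial form a null set
    and the segment has positive length. *)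
Lemma Rintegral_sqr_poly_eq0 p (a b : R) : a < b ->
  \int[mu]_(t in `[a, b]) (p.[t] ^+ 2) = 0 -> p = 0.
Proof.
move=> ab p20; apply/eqP/negPn/negP => p0.
have cp : continuous (fun t => p.[t] ^+ 2).
  by under eq_fun do rewrite -horner_exp; exact: continuous_horner.
have ip := @continuous_integrable_segment _ a b cp.
have : (\int[mu]_(t in `[a, b]) `|(p.[t] ^+ 2)%:E| = 0)%E.
  under eq_integral do rewrite gee0_abs ?lee_fin ?sqr_ge0//.
  by rewrite -(fineK (integrable_fin_num _ ip))//; congr EFin.
move/ae_eq_integral_abs => /(_ _)[]//; first exact: (measurable_int mu).
move=> N [mN N0 sub].
have cr : countable [set x | root p x].
  by apply: finite_set_countable; exact: finite_roots.
have mr : measurable [set x | root p x].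
  by apply: countable_measurable => // t; exact: measurable_set1.
have : (mu `[a, b] <= mu (N `|` [set x | root p x]))%E.
  apply: le_measure; rewrite ?inE//; first exact: measurableU.
  move=> x abx; have [px|npx] := boolP (root p x); [by right|left].
  apply: sub => /= /(_ abx) [] /eqP; rewrite sqrf_eq0 => px0.
  by move: npx; rewrite /root px0.
rewrite measureU0//; last first.
  exact: countable_lebesgue_measure0.
by rewrite [X in (_ <= X)%E]N0 lebesgue_measure_itv /= lte_fin ab
  -EFinB lee_fin subr_le0 leNgt ab.
Qed.

Definition integral01 p : R := \int[mu]_(t in `[0, 1]) p.[t].

Lemma integral01D p q : integral01 (p + q) = integral01 p + integral01 q.
Proof.
rewrite /integral01 -Rintegral_segmentD; [|exact: continuous_horner..].
by apply: eq_Rintegral => t _; rewrite hornerD.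
Qed.

Lemma integral01Z c p : integral01 (c *: p) = c * integral01 p.
Proof.
rewrite /integral01 -Rintegral_segmentZl; last exact: continuous_horner.
by apply: eq_Rintegral => t _; rewrite hornerZ.
Qed.

Lemma integral01Zl c p q : integral01 (c *: p * q) = c * integral01 (p * q).
Proof. by rewrite -scalerAl integral01Z. Qed.

Lemma integral01Xn n : integral01 ('X^n) = n.+1%:R^-1 :> R.
Proof.
rewrite /integral01 /Rintegral.
pose P : {poly R} := n.+1%:R^-1 *: 'X^(n.+1).
rewrite (@continuous_FTC2 _ _ (horner P))//.
- by rewrite /= !hornerE expr1n expr0n /= mulr0 subr0 mulr1.
- by apply: continuous_subspaceT; exact: continuous_horner.
- split.
  + by move=> x _; exact: derivable_horner.
  + by apply: cvg_at_right_filter; exact: continuous_horner.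
  + by apply: cvg_at_left_filter; exact: continuous_horner.
- move=> x _; rewrite -derivE /P derivZ derivXn /= hornerZ hornerMn.
  by rewrite -[X in _ * X]mulr_natl mulKf ?pnatr_eq0.
Qed.

End SegmentIntegral.

(** * Moments of sparse polynomials on [[0, 1]] *)

Section MellinMoments.
Context {R : realType}.
Implicit Types (S : seq nat) (p q : {poly R}) (m n s c d i : nat).

Definition supported S p : Prop := forall i, i \notin S -> p`_i = 0.

Lemma supportedD S p q : supported S p -> supported S q -> supported S (p + q).
Proof. by move=> Sp Sq i iS; rewrite coefD Sp ?Sq// addr0. Qed.

Lemma supportedZ S a p : supported S p -> supported S (a *: p).
Proof. by move=> Sp i iS; rewrite coefZ Sp// mulr0. Qed.

Lemma supported_sub S S' p : {subset S <= S'} -> supported S p ->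
  supported S' p.
Proof. by move=> SS' Sp i iS'; apply: Sp; apply: contra iS'; exact: SS'. Qed.

(** Equal moments on [S] weigh every coefficient of [p] by the same [K], and the coefficients sum to
    [p.[1]]. *)
Lemma integral01_supported S p q (K : R) : supported S p ->
  (forall c, c \in S -> integral01 (q * 'X^c) = K) ->
  integral01 (q * p) = K * p.[1].
Proof.
move=> Sp qK.
have intsum (F : nat -> {poly R}) k :
    integral01 (\sum_(i < k) F i) = \sum_(i < k) integral01 (F i).
  elim: k => [|k IH]; last by rewrite !big_ord_recr /= integral01D IH.
  by rewrite !big_ord0 -[0](scale0r (0 : {poly R})) integral01Z mul0r.
rewrite -{1}[p]coefK poly_def mulr_sumr (intsum (fun i => q * (p`_i *: 'X^i))).
rewrite horner_coef mulr_sumr; apply: eq_bigr => i _.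
rewrite -scalerAr integral01Z expr1n mulr1 mulrC.
by have [iS|/Sp ->] := boolP (val i \in S); [rewrite qK|rewrite !(mulr0,mul0r)].
Qed.

(** The [Z] of the overview for an arbitrary exponent list. The difference is taken in [R], since
    [s] may be smaller than [c]; the natural zeros are exactly the members of [S]. *)
Definition mellin_factor S s : R :=
  \prod_(c <- S) ((s%:R - c%:R) / (s + c).+1%:R).

Lemma mellin_factor_eq0 S c : c \in S -> mellin_factor S c = 0.
Proof.
by move=> cS; apply/eqP; rewrite prodf_seq_eq0; apply/hasP; exists c;
  rewrite //= subrr mul0r.
Qed.

Lemma mellin_factor_neq0 S s : s \notin S -> mellin_factor S s != 0.
Proof.
move=> sS; rewrite prodf_seq_neq0; apply/allP => c cS /=.
rewrite mulf_neq0 ?invr_eq0 ?pnatr_eq0// subr_eq0 eqr_nat.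
by apply: contra sS => /eqP ->.
Qed.

(* Up to a factor, the Muntz-Legendre polynomial of the exponents m :: S. *)
Lemma mellin_monomial S m : uniq S -> m \notin S -> exists q,
  [/\ supported (m :: S) q, q`_m * mellin_factor S m = 1, q.[1] = 1 &
      forall s, integral01 (q * 'X^s) = mellin_factor S s / (s + m).+1%:R].
Proof.
elim: S m => [|d S IH] m /=.
  move=> _ _; exists 'X^m; split.
  - by move=> i; rewrite inE coefXn => /negbTE ->.
  - by rewrite coefXn eqxx /mellin_factor big_nil mulr1.
  - by rewrite hornerXn expr1n.
  - move=> s; rewrite -exprD integral01Xn /mellin_factor big_nil mul1r.
    by rewrite addnC.
move=> /andP[dS uS]; rewrite inE negb_or => /andP[md mS].
have [p [Sp pd p1 Fp]] := IH _ uS dS.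
have [q [Sq qm q1 Fq]] := IH _ uS mS.
have md0 : m%:R - d%:R != 0 :> R by rewrite subr_eq0 eqr_nat.
(* Partial fractions: these are the residues of [(s - d) / ((s + d + 1) (s + m + 1))] at
   [s = - d - 1] and [s = - m - 1]. *)
exists ((- (d.*2.+1)%:R / (m%:R - d%:R)) *: p
        + ((m + d).+1%:R / (m%:R - d%:R)) *: q); split.
- apply: supportedD; apply: supportedZ.
    by apply: supported_sub Sp => i; rewrite !inE orbC => /orP[->|->];
      rewrite !orbT.
  by apply: supported_sub Sq => i; rewrite !inE => /orP[->|->]; rewrite ?orbT.
- rewrite coefD !coefZ Sp ?inE ?negb_or ?md// mulr0 add0r.
  rewrite /mellin_factor big_cons -/(mellin_factor S m).
  have : (m + d).+1%:R != 0 :> R by rewrite pnatr_eq0.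
  by rewrite -[RHS]qm -!natr1 !natrD => s1; field; rewrite md0 s1.
- rewrite hornerD !hornerZ p1 q1 !mulr1 -mulrDl.
  rewrite -[(m + d).+1%:R]natr1 -[(d.*2.+1)%:R]natr1 -muln2 natrM natrD.
  by field.
- move=> s; rewrite mulrDl integral01D !integral01Zl Fp Fq.
  rewrite /mellin_factor big_cons -/(mellin_factor S s).
  have s1 : (s + d).+1%:R != 0 :> R by rewrite pnatr_eq0.
  have s2 : (s + m).+1%:R != 0 :> R by rewrite pnatr_eq0.
  move: s1 s2; rewrite -!natr1 !natrD -muln2 natrM => s1 s2.
  by field; rewrite s1 s2 md0.
Qed.

(** The factor of a new exponent [d] is [1 - (2 d + 1) / (s + d + 1)], so adding [d] changes
    [1 - Z(s)] by [2 d + 1] times the moments given by [mellin_monomial]. On [S] itself all moments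
    are 1. *)
Lemma mellin_constant S : uniq S -> exists q,
  [/\ supported S q, q.[1] = \sum_(c <- S) c.*2.+1%:R &
      forall s, integral01 (q * 'X^s) = 1 - mellin_factor S s].
Proof.
elim: S => [|d S IH] /=.
  move=> _; exists 0; split.
  - by move=> i _; rewrite coef0.
  - by rewrite horner0 big_nil.
  - move=> s; rewrite mul0r /mellin_factor big_nil subrr.
    by rewrite -[0](scale0r (0 : {poly R})) integral01Z mul0r.
move=> /andP[dS uS].
have [p [Sp pd p1 Fp]] := mellin_monomial uS dS.
have [q [Sq q1 Fq]] := IH uS.
exists (d.*2.+1%:R *: p + q); split.
- apply: supportedD; first exact: supportedZ.
  by apply: supported_sub Sq => i; rewrite inE orbC => ->.
- by rewrite hornerD hornerZ p1 q1 mulr1 big_cons.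
- move=> s; rewrite mulrDl integral01D !integral01Zl Fp Fq.
  rewrite /mellin_factor big_cons -/(mellin_factor S s).
  have : (s + d).+1%:R != 0 :> R by rewrite pnatr_eq0.
  rewrite -!natr1 !natrD -muln2 natrM => s1.
  by field.
Qed.

End MellinMoments.

(** * The exponents below [n] of the parity of [n - 1], and the moments they determine *)

Fixpoint parity_exponents n : seq nat :=
  if n is n'.+1 then
    if n' is n''.+1 then n' :: parity_exponents n'' else [:: 0%N]
  else [::].

(** Follows the recursion of [parity_exponents]: one step adds one exponent. *)
Lemma nat_ind2 (P : nat -> Prop) :
  P 0%N -> P 1%N -> (forall n, P n -> P n.+2) -> forall n, P n.
Proof.
move=> P0 P1 PS n; suff [] : P n /\ P n.+1 by [].
by elim: n => // n [Pn Pn1]; split => //; exact: PS.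
Qed.

Lemma mem_parity_exponents n c :
  (c \in parity_exponents n) = (c < n)%N && (odd c != odd n).
Proof.
elim/nat_ind2: n c => [|[]|n IH c] //=; rewrite inE IH; lia.
Qed.

Lemma uniq_parity_exponents n : uniq (parity_exponents n).
Proof.
by elim/nat_ind2: n => //= n IH; rewrite mem_parity_exponents IH; lia.
Qed.

Section ParityMoments.
Context {R : realType}.
Implicit Types (p q : {poly R}) (m n s c : nat).

Notation Z n s := (@mellin_factor R (parity_exponents n) s).

(** The sum of [2 c + 1] over [parity_exponents n], which is the value at 1 of the polynomial of
    [mellin_constant]. *)
Definition end_weight n : R := (n * n.+1)%:R / 2.

Lemma end_weightE n :
  end_weight n = \sum_(c <- parity_exponents n) c.*2.+1%:R.
Proof.
rewrite /end_weight; elim/nat_ind2: n => [||n IH] /=.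
- by rewrite big_nil mul0r.
- by rewrite big_seq1 mulfV// pnatr_eq0.
- by rewrite big_cons -IH !natrM -addnn -!addnS !natrD -!natr1; field.
Qed.

Lemma end_weight_neq0 n : (0 < n)%N -> end_weight n != 0.
Proof.
by move=> n0; rewrite mulf_neq0 ?invr_eq0 ?pnatr_eq0// -lt0n muln_gt0 n0.
Qed.

(** The quotient [Z(s + 2) / Z(s)] telescopes. What remains at the lower end is [(s + 1) (s + 2)]
    whether the smallest exponent is 0 or 1. Denominators are cleared because [s + 1 - n] may
    vanish. *)
Lemma mellin_factor_shift2 n s :
  Z n s.+2 * (s%:R + 1 - n%:R) * (s + n).+2%:R
  = Z n s * s.+1%:R * s.+2%:R.
Proof.
elim/nat_ind2: n => [||n IH].
- rewrite /mellin_factor /= !big_nil addn0 subr0 natr1; ring.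
- rewrite /mellin_factor /= !big_seq1 addn0.
  have : s.+3%:R != 0 :> R by rewrite pnatr_eq0.
  have : s.+1%:R != 0 :> R by rewrite pnatr_eq0.
  by rewrite addn0 addn1 -!natr1 => h1 h3; field; rewrite h1 h3.
- have Zcons k : Z n.+2 k = (k%:R - n.+1%:R) / (k + n.+1).+1%:R * Z n k.
    by rewrite /mellin_factor /= big_cons.
  have : (s + n).+2%:R != 0 :> R by rewrite pnatr_eq0.
  have : (s + n).+4%:R != 0 :> R by rewrite pnatr_eq0.
  rewrite !Zcons !(addSn, addnS) => h4 h2.
  transitivity (Z n s.+2 * (s%:R + 1 - n%:R) * (s + n).+2%:R
    * ((s%:R - n.+1%:R) / (s + n).+2%:R)).
    by move: h4 h2; rewrite -!natr1 natrD => h4 h2; field; rewrite h4 h2.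
  by rewrite IH; move: h2; rewrite -!natr1 natrD => h2; field.
Qed.

(** The shift relation at [s = n - 2], where [s + 1 - n = -1]. It lets [u_{n,0}] and [u_{n,2}] share
    the factor [Z(n - 2)]. *)
Lemma mellin_factor_top n : (2 <= n)%N ->
  Z n n = - (n%:R - 1) / 2 * Z n (n - 2).
Proof.
case: n => [|[|n]] // _; rewrite subSS subSS subn0.
have := mellin_factor_shift2 n.+2 n.
rewrite -!natr1 !natrD -!natr1.
have n1 : n%:R + 1 != 0 :> R by rewrite natr1 pnatr_eq0.
have n2 : n%:R + 1 + 1 != 0 :> R by rewrite !natr1 pnatr_eq0.
set x := Z _ _; set y := Z _ _ => h.
have {}h : x * (n%:R + 1 + 1) * -2 = y * (n%:R + 1) * (n%:R + 1 + 1).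
  by rewrite -h; ring.
apply: (mulIf n2); apply: (mulIf (_ : -2 != 0 :> R)); first by rewrite oppr_eq0.
by rewrite h; field.
Qed.

(* On [0, 1] this is u_{n, n - m}. *)
Lemma residual_polynomial n m : (0 < n)%N -> m \notin parity_exponents n ->
  exists q,
  [/\ supported (m :: parity_exponents n) q, q`_m = - 1, q.[1] = 0 &
      forall s, integral01 (q * 'X^s) =
        Z n m / end_weight n
        - Z n m * Z n s * ((end_weight n)^-1 + (s + m).+1%:R^-1)].
Proof.
move=> n0 mn; have un := uniq_parity_exponents n.
have [p [Sp pm p1 Fp]] := @mellin_monomial R _ _ un mn.
have [q [Sq q1 Fq]] := @mellin_constant R _ un.
have w0 := end_weight_neq0 n0.
(* The first coefficient normalises the coefficient of ['X^m] to -1; the second then forces the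
   value 0 at 1, because [q.[1]] is [end_weight n]. *)
exists (- Z n m *: p + (Z n m / end_weight n) *: q); split.
- apply: supportedD; apply: supportedZ => //.
  by apply: supported_sub Sq => i; rewrite inE orbC => ->.
- by rewrite coefD !coefZ Sq// mulr0 addr0 mulNr mulrC pm.
- by rewrite hornerD !hornerZ p1 q1 -end_weightE mulr1 mulfVK// addNr.
- move=> s; rewrite mulrDl integral01D !integral01Zl Fp Fq.
  have s1 : (s + m).+1%:R != 0 :> R by rewrite pnatr_eq0.
  move: w0 s1; move: (end_weight n) (s + m).+1%:R => w k w0 k0.
  by field; rewrite w0 k0.
Qed.

(** Integration against this polynomial is evaluation at 1, up to the factor [1 / W], on polynomials
    with these exponents. The polynomials for [n] and [n + 1] are the two parity components of
    [r0 n]. *)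
Lemma endpoint_polynomial n : (0 < n)%N -> exists q : {poly R},
  [/\ supported (parity_exponents n) q, q.[1] = 1 &
      forall c, c \in parity_exponents n ->
        integral01 (q * 'X^c) = (end_weight n)^-1].
Proof.
move=> n0; have un := uniq_parity_exponents n.
have [q [Sq q1 Fq]] := @mellin_constant R _ un.
exists ((end_weight n)^-1 *: q); split.
- exact: supportedZ.
- by rewrite hornerZ q1 -end_weightE mulVf// end_weight_neq0.
- move=> c cn; rewrite integral01Zl Fq mellin_factor_eq0//.
  by rewrite subr0 mulr1.
Qed.

End ParityMoments.

(** * Projection onto the polynomials vanishing at the endpoints *)

Section Projection.
Context {R : realType}.
Notation mu := (@lebesgue_measure R).
Implicit Types (f g h : R -> R) (p q : {poly R}) (m n N s c : nat).

Lemma continuousM_fun f g : continuous f -> continuous g ->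
  continuous (fun t => f t * g t).
Proof. by move=> cf cg t; apply: cvgM; [exact: cf|exact: cg]. Qed.

Lemma continuousD_fun f g : continuous f -> continuous g ->
  continuous (fun t => f t + g t).
Proof. by move=> cf cg t; apply: cvgD; [exact: cf|exact: cg]. Qed.

Lemma continuousZ_fun f (a : R) : continuous f -> continuous (fun t => a * f t).
Proof. by move=> cf; apply: continuousM_fun => // t; exact: cvg_cst. Qed.

Lemma continuous_oppr_comp f : continuous f -> continuous (fun t => f (- t)).
Proof.
by move=> cf t; apply: continuous_comp; [exact: opp_continuous|exact: cf].
Qed.

Lemma inner_linear f g h (a b : R) :
  continuous f -> continuous g -> continuous h ->
  inner (fun t => a * f t + b * g t) h = a * inner f h + b * inner g h.
Proof.
move=> cf cg ch; have cfh := continuousM_fun cf ch.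
have cgh := continuousM_fun cg ch.
rewrite /inner -!Rintegral_segmentZl// -Rintegral_segmentD; last first.
- exact: continuousZ_fun.
- exact: continuousZ_fun.
by apply: eq_Rintegral => t _; rewrite mulrDl !mulrA.
Qed.

Lemma inner_even f g : continuous f -> continuous g ->
  (forall t, f (- t) * g (- t) = f t * g t) ->
  inner f g = 2 * \int[mu]_(t in `[0, 1]) (f t * g t).
Proof.
move=> cf cg fg; have cfg := continuousM_fun cf cg.
rewrite /inner Rintegral_symmetric_segment// -Rintegral_segmentZl//.
by apply: eq_Rintegral => t _; rewrite fg mulr_natl mulr2n.
Qed.

Lemma coef_comp_polyN p i : (p \Po (- 'X))`_i = (-1) ^+ i * p`_i.
Proof.
have -> : p \Po (- 'X) = \poly_(k < size p) ((-1) ^+ k * p`_k).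
  rewrite comp_polyE poly_def; apply: eq_bigr => k _.
  rewrite [(- 'X) ^+ _]exprNn -signr_odd mulr_sign -signr_odd mulr_sign.
  by case: (odd k); rewrite ?(scaleNr, scalerN).
rewrite coef_poly; case: ltnP => // /(nth_default 0) ->; exact/esym/mulr0.
Qed.

(** Folding onto [[0, 1]] replaces [p] by [p + (-1)^(n+1) p(-X)]. Coefficients of degree congruent
    to [n] cancel, the top one included, so the sum is supported on [parity_exponents n] and only
    its value at 1 counts. *)
Lemma inner_parity n f q p (K : R) : continuous f ->
  (forall t, f (- t) = (-1) ^+ n.+1 * f t) ->
  (forall t, 0 <= t -> f t = q.[t]) ->
  (forall c, c \in parity_exponents n -> integral01 (q * 'X^c) = K) ->
  (size p <= n.+1)%N ->
  inner f (horner p) = K * (p.[1] + (-1) ^+ n.+1 * p.[-1]).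
Proof.
move=> cf fN fq qK sp.
pose r : {poly R} := p + (-1) ^+ n.+1 *: (p \Po (- 'X)).
have Sr : supported (parity_exponents n) r.
  move=> i; rewrite mem_parity_exponents coefD coefZ coef_comp_polyN.
  have [ni|ni] := leqP n.+1 i.
    by rewrite nth_default ?(leq_trans sp)// !mulr0 addr0.
  move=> h; rewrite mulrA -exprD -signr_odd.
  have -> : odd (n.+1 + i) by lia.
  by rewrite mulN1r subrr.
have cp := @continuous_horner R p.
have rE t : r.[t] = p.[t] + (-1) ^+ n.+1 * p.[- t].
  by rewrite /r hornerD hornerZ horner_comp hornerN hornerX.
rewrite -rE -(integral01_supported Sr qK) /inner.
rewrite Rintegral_symmetric_segment//; last exact: continuousM_fun.
apply: eq_Rintegral => t; rewrite inE /= in_itv /= => /andP[t0 _].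
by rewrite fN hornerM rE fq//; ring.
Qed.

Lemma is_proj_unique N f p q : continuous f ->
  is_proj N f p -> is_proj N f q -> p = q.
Proof.
move=> cf [[sp pN p1] fp] [[sq qN q1] fq].
have [cp cq] := (@continuous_horner R p, @continuous_horner R q).
have vd : vanishing_poly N (p - q).
  split; rewrite ?hornerD ?hornerN ?pN ?qN ?p1 ?q1 ?subrr//.
  by rewrite (leq_trans (size_polyD _ _))// geq_max sp size_polyN.
apply/eqP; rewrite -subr_eq0; apply/eqP.
apply: (@Rintegral_sqr_poly_eq0 _ _ (-1) 1); first lra.
have cd := @continuous_horner R (p - q).
have c1 r : continuous (fun t => f t - r.[t]).
  move=> t; apply: cvgB; first exact: cf.
  exact: continuous_horner.
have := @inner_linear _ _ _ 1 (-1) (c1 q) (c1 p) cd.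
rewrite fp// fq// !mulr0 addr0 => <-.
apply: eq_Rintegral => t _; rewrite hornerD hornerN; ring.
Qed.

(** By uniqueness, any exhibited projection is the one chosen by [xget]; residuals can thus be
    computed from explicit candidates. *)
Lemma resid_proj N f p t : continuous f -> is_proj N f p ->
  resid N f t = f t - p.[t].
Proof.
move=> cf fp; rewrite /resid /proj; congr (_ - _.[_]).
by apply: xget_unique => // q fq; exact: (is_proj_unique cf fq fp).
Qed.

End Projection.

(** * Explicit residuals of [1 + t] and of [ubar m] *)

Section Residuals.
Context {R : realType}.
Notation mu := (@lebesgue_measure R).
Notation Z n s := (@mellin_factor R (parity_exponents n) s).
Notation W n := (@end_weight R n).
Implicit Types (f g h : R -> R) (p q : {poly R}) (m n N s c : nat).

Lemma horner_supported_opp n p t : supported (parity_exponents n) p ->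
  p.[- t] = (-1) ^+ n.+1 * p.[t].
Proof.
move=> Sp; rewrite !horner_coef mulr_sumr; apply: eq_bigr => i _.
have [|/Sp ->] := boolP (val i \in parity_exponents n); last first.
  by rewrite !(mul0r, mulr0).
rewrite mem_parity_exponents => /andP[_ h].
rewrite [(- t) ^+ i]exprNn -signr_odd -[(-1) ^+ n.+1]signr_odd.
have -> : odd n.+1 = odd i by lia.
by rewrite mulrCA.
Qed.

Lemma size_supported n p : supported (parity_exponents n) p -> (size p <= n)%N.
Proof.
move=> Sp; apply/leq_sizeP => j nj; apply: Sp.
by rewrite mem_parity_exponents ltnNge nj.
Qed.

Lemma inner_endpoint n q p : supported (parity_exponents n) q ->
  (forall c, c \in parity_exponents n -> integral01 (q * 'X^c) = (W n)^-1) ->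
  (size p <= n.+1)%N ->
  inner (horner q) (horner p) = (W n)^-1 * (p.[1] + (-1) ^+ n.+1 * p.[-1]).
Proof.
move=> Sq qK sp; apply: (@inner_parity _ n _ q) => //.
  exact: continuous_horner.
by move=> t; exact: horner_supported_opp.
Qed.

(** The endpoint polynomials for [n] and [n + 1] have opposite parities, so their sum is 2 at 1 and
    0 at -1, like [1 + t]. Each is orthogonal to the polynomials of degree at most [n] vanishing at
    both ends. *)
Lemma r0_spec n : (0 < n)%N -> exists p q : {poly R},
  [/\ supported (parity_exponents n) p, p.[1] = 1 &
      forall c, c \in parity_exponents n -> integral01 (p * 'X^c) = (W n)^-1] /\
  [/\ supported (parity_exponents n.+1) q, q.[1] = 1,
      forall c, c \in parity_exponents n.+1 ->
        integral01 (q * 'X^c) = (W n.+1)^-1 &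
      forall t, r0 n t = (p + q).[t]].
Proof.
move=> n0; have [p [Sp p1 Fp]] := @endpoint_polynomial R n n0.
have [q [Sq q1 Fq]] := @endpoint_polynomial R n.+1 isT.
exists p, q; split; split => // t.
have pN : p.[-1] = (-1) ^+ n.+1 by rewrite (horner_supported_opp _ Sp) p1 mulr1.
have qN : q.[-1] = - (-1) ^+ n.+1.
  by rewrite (horner_supported_opp _ Sq) q1 mulr1 exprS mulN1r.
have [l [sl lE]] : exists l : {poly R},
    (size l <= 2)%N /\ forall x, 1 + x = l.[x].
  exists (1 + 'X); split => [|x]; last by rewrite !hornerE.
  by rewrite (leq_trans (size_polyD _ _))// size_poly1 size_polyX.
have cl : continuous (fun t : R => 1 + t).
  by move=> x; apply: cvgD; [exact: cvg_cst|exact: cvg_id].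
rewrite /r0 (@resid_proj _ _ _ (l - (p + q)))//.
  by rewrite lE hornerD hornerN; ring.
split.
  split; last 2 first.
  - by rewrite hornerD hornerN -lE hornerD pN qN; ring.
  - by rewrite hornerD hornerN -lE hornerD p1 q1; ring.
  have spq : (size (p + q)%R <= n.+1)%N.
    rewrite (leq_trans (size_polyD _ _))// geq_max.
    by rewrite (size_supported Sq) (leq_trans (size_supported Sp)).
  by rewrite (leq_trans (size_polyD _ _))// geq_max size_polyN (leq_trans sl).
move=> r [sr rN r1].
rewrite -[RHS](_ : 1 * inner (horner p) (horner r)
                   + 1 * inner (horner q) (horner r) = 0).
  rewrite -inner_linear; [|exact: continuous_horner..].
  by apply: eq_Rintegral => x _; rewrite lE hornerD hornerN hornerD; ring.
rewrite (inner_endpoint Sp Fp)// (inner_endpoint Sq Fq) ?(leq_trans sr)//.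
by rewrite rN r1 !(mulr0, addr0).
Qed.

Lemma ubarE m : exists e : {poly R},
  [/\ (size e <= 2)%N, e.[1] = 1, (forall t, e.[- t] = (-1) ^+ m.+1 * e.[t]) &
      forall t, ubar m t = e.[t] - `|t| * t ^+ m.-1].
Proof.
exists (if odd m then 1 else 'X); rewrite -signr_odd /ubar /=.
case: (odd m) => /=; split.
- by rewrite size_poly1.
- by rewrite hornerE.
- by move=> t; rewrite !hornerE ?expr0 ?mul1r.
- by move=> t; rewrite hornerE.
- by rewrite size_polyX.
- by rewrite hornerX.
- by move=> t; rewrite !hornerX ?expr1 mulN1r.
- by move=> t; rewrite hornerX.
Qed.

Lemma continuous_ubar m : continuous (@ubar R m).
Proof.
have [e [_ _ _ uE]] := ubarE m.
rewrite (_ : ubar m = fun t => e.[t] + - (`|t| * ('X^(m.-1)).[t])); last first.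
  by apply/funext => t; rewrite uE hornerXn.
apply: continuousD_fun; first exact: continuous_horner.
move=> t; apply: cvgN; apply: cvgM; first exact: norm_continuous.
exact: continuous_horner.
Qed.

(** The polynomial [q] of [residual_polynomial], extended from [[0, 1]] with parity [n + 1], differs
    from [ubar m] by a polynomial vanishing at both ends. Its constant moments on
    [parity_exponents n] give the orthogonality through [inner_parity]. *)
Lemma resid_ubar_spec n m : (0 < m <= n)%N -> odd m = odd n -> exists q,
  [/\ [/\ supported (m :: parity_exponents n) q, q`_m = - 1 & q.[1] = 0],
      forall s, integral01 (q * 'X^s) =
        Z n m / W n - Z n m * Z n s * ((W n)^-1 + (s + m).+1%:R^-1),
      continuous (resid n (@ubar R m)),
      forall t, resid n (@ubar R m) (- t) = (-1) ^+ n.+1 * resid n (ubar m) t &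
      forall t, 0 <= t -> resid n (@ubar R m) t = q.[t]].
Proof.
move=> /andP[m0 mn] mnodd.
have mS : m \notin parity_exponents n.
  by rewrite mem_parity_exponents mnodd eqxx andbF.
have n0 : (0 < n)%N by rewrite (leq_trans m0).
have [q [Sq qm q1 Fq]] := @residual_polynomial R n m n0 mS.
have [e [se e1 eN ue]] := ubarE m.
(* Adding ['X^m] removes the one exponent outside [parity_exponents n]; in the extension that
   monomial becomes [|t| t^(m-1)]. *)
pose r := q + 'X^m.
have Sr : supported (parity_exponents n) r.
  move=> i iS; rewrite coefD coefXn; have [->|im] := eqVneq i m.
    by rewrite qm addNr.
  by rewrite Sq ?inE ?negb_or ?im// addr0.
have sgE : (-1) ^+ m.+1 = (-1) ^+ n.+1 :> R.
  by rewrite -signr_odd -[RHS]signr_odd /= mnodd.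
pose f t := r.[t] - `|t| * t ^+ m.-1.
have fE t : ubar m t - (e - r).[t] = f t.
  by rewrite ue /f hornerD hornerN; ring.
have fN t : f (- t) = (-1) ^+ n.+1 * f t.
  rewrite /f (horner_supported_opp _ Sr) normrN mulrBr [(- t) ^+ _]exprNn -sgE.
  have -> : (-1) ^+ m.-1 = (-1) ^+ m.+1 :> R.
    by rewrite -[in RHS](prednK m0) !exprS !mulN1r opprK.
  by rewrite mulrCA.
have fq t : 0 <= t -> f t = q.[t].
  move=> t0; rewrite /f ger0_norm// -exprS prednK// /r hornerD hornerXn; ring.
have cub := @continuous_ubar m.
have cf : continuous f.
  rewrite (_ : f = fun t => ubar m t - (e - r).[t]); last first.
    by apply/funext => t; rewrite fE.
  by move=> t; apply: cvgB; [exact: cub|exact: continuous_horner].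
have FqS c : c \in parity_exponents n -> integral01 (q * 'X^c) = Z n m / W n.
  by move=> cS; rewrite Fq (@mellin_factor_eq0 R _ _ cS) mulr0 mul0r subr0.
have projE : is_proj n (ubar m) (e - r).
  split.
    split.
    - rewrite (leq_trans (size_polyD _ _))// geq_max size_polyN.
      by rewrite (leq_trans se)// (leq_trans (size_supported Sr)).
    - rewrite hornerD hornerN eN (horner_supported_opp _ Sr) sgE /r hornerD.
      by rewrite hornerXn expr1n q1 e1; ring.
    - by rewrite hornerD hornerN /r hornerD hornerXn expr1n q1 e1; ring.
  move=> p [sp pN p1].
  rewrite -[RHS](_ : Z n m / W n * (p.[1] + (-1) ^+ n.+1 * p.[-1]) = 0).
    rewrite -(inner_parity cf fN fq FqS sp).
    by apply: eq_Rintegral => t _; rewrite fE.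
  by rewrite pN p1 mulr0 addr0 mulr0.
have residE : resid n (@ubar R m) = f.
  by apply/funext => t; rewrite (resid_proj _ cub projE) fE.
by exists q; rewrite residE; split.
Qed.

End Residuals.

(** * The Gram matrix and the choice of [alpha] *)

Section Orthogonality.
Context {R : realType}.
Notation mu := (@lebesgue_measure R).
Notation Z n s := (@mellin_factor R (parity_exponents n) s).
Notation W n := (@end_weight R n).
Implicit Types (f g h : R -> R) (p q : {poly R}) (m n N s c : nat).

(** For [n >= 2] this is [alpha] times [Z(n) / Z(n - 2)], by [mellin_factor_top]. *)
Definition alpha_ratio n : R := - (n%:R - 1) / 2 * alpha R n.

(** At [x = n], [w = W n], [b = alpha_ratio n] this is the squared norm of [w_n] divided by
    [2 Z(n - 2)^2]. The entries of the form are [1 / W + 1 / (m + m' + 1)] with [m], [m'] in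
    [{n, n - 2}]. *)
Definition gram_form (x w b : R) : R :=
  b ^+ 2 * (w^-1 + (2 * x + 1)^-1) + 2 * b * (w^-1 + (2 * x - 1)^-1)
  + (w^-1 + (2 * x - 3)^-1).

Lemma gram_form_gt0 (x w b : R) : 3 <= x -> 0 < w -> 0 < gram_form x w b.
Proof.
move=> x3 w0.
have x1 : 0 < 2 * x + 1 by lra.
have x2 : 0 < 2 * x - 1 by lra.
have x4 : 0 < 2 * x - 3 by lra.
(* Completing the square in [b] separately for the terms with and without [w]; the last summand is
   the positive remainder. *)
have -> : gram_form x w b = (b + 1) ^+ 2 / w
    + (b + (2 * x + 1) / (2 * x - 1)) ^+ 2 / (2 * x + 1)
    + 4 / ((2 * x - 3) * (2 * x - 1) ^+ 2).
  by rewrite /gram_form; field; rewrite !gt_eqF.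
apply: ltr_wpDl.
  by apply: addr_ge0; apply: divr_ge0; rewrite ?sqr_ge0// ltW.
by rewrite divr_gt0// mulr_gt0// exprn_gt0.
Qed.

(** The cancellation required by [q_l_orth], as a quadratic equation for [alpha_ratio n]. The
    radicals only enter through the square of their product [y]. *)
Lemma alpha_ratio_eq n : (3 <= n)%N ->
  gram_form n%:R (W n) (alpha_ratio n) * ((W n)^-1 - (W n.+1)^-1)
  = ((alpha_ratio n + 1) / W n) ^+ 2.
Proof.
move=> n3; rewrite /alpha_ratio /alpha /end_weight !natrM.
rewrite -[n.+2%:R]natr1 -[n.+1%:R]natr1.
have : 3 <= n%:R :> R by rewrite ler_nat.
move: n%:R => x x3; rewrite -[2 * Num.sqrt 3 * _]mulrA.
set y := Num.sqrt 3 * Num.sqrt _.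
have x1 : x - 1 != 0 by rewrite gt_eqF//; lra.
have x23 : 2 * x - 3 != 0 by rewrite gt_eqF//; lra.
have x21 : 2 * x - 1 != 0 by rewrite gt_eqF//; lra.
have x2p1 : 2 * x + 1 != 0 by rewrite gt_eqF//; lra.
have x0 : x != 0 by rewrite gt_eqF//; lra.
have xp1 : x + 1 != 0 by rewrite gt_eqF//; lra.
have xp2 : x + 1 + 1 != 0 by rewrite gt_eqF//; lra.
have y2 : y ^+ 2 * ((2 * x - 3) * (x - 1)) = 3 * ((2 * x + 1) * (x + 1)).
  rewrite exprMn !sqr_sqrtr//; first by field; rewrite x23 x1.
  by apply: divr_ge0; apply: mulr_ge0; lra.
(* [d] is [1 / W n - 1 / W n.+1], and [a] is the leading coefficient of the quadratic in [b]. Its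
   roots lie symmetrically about the part of [b] free of [y]. *)
pose d := 4 / (x * (x + 1) * (x + 1 + 1)).
pose a := d * (2 / (x * (x + 1)) + (2 * x + 1)^-1) - 4 / (x * (x + 1)) ^+ 2.
apply/eqP; rewrite -subr_eq0; apply/eqP.
transitivity (4 * a * (x - 1) / ((x * (2 * x - 1)) ^+ 2 * (2 * x - 3)) *
  (y ^+ 2 * ((2 * x - 3) * (x - 1)) - 3 * ((2 * x + 1) * (x + 1)))); last first.
  by rewrite y2 subrr mulr0.
rewrite /a /d /gram_form; move: y {y2} => y.
by field; rewrite ?(x1, x23, x21, x2p1, x0, xp1, xp2).
Qed.

(** Here [z] is [Z(n - 2)], and [q] combines the polynomials of [u_{n,0}] and [u_{n,2}] on [[0, 1]];
    by [mellin_factor_top] both moment constants are multiples of [z / W]. *)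
Lemma w_spec n : (3 <= n)%N -> exists q (z : R),
  [/\ z != 0, (size q <= n.+1)%N, q.[1] = 0 &
      forall c, c \in parity_exponents n ->
        integral01 (q * 'X^c) = z * (alpha_ratio n + 1) / W n] /\
  [/\ continuous (@w R n), forall t : R, w n (- t) = (-1) ^+ n.+1 * w n t,
      forall t, 0 <= t -> w n t = q.[t] &
      inner (@w R n) (w n) = 2 * z ^+ 2 * gram_form n%:R (W n) (alpha_ratio n)].
Proof.
move=> n3; have n0 : (0 < n)%N by lia.
have [q0 [[S0 c0 e0] F0 cu0 p0 uq0]] := @resid_ubar_spec R n n ltac:(lia) erefl.
have [q2 [[S2 c2 e2] F2 cu2 p2 uq2]] := @resid_ubar_spec R n (n - 2)
  ltac:(lia) ltac:(lia).
have wE t :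
    w n t = alpha R n * resid n (ubar n) t + 1 * resid n (ubar (n - 2)) t.
  by rewrite /w /u subn0 mul1r.
have Ztop := @mellin_factor_top R n ltac:(lia).
have z0 : Z n (n - 2) != 0.
  by apply: mellin_factor_neq0; rewrite mem_parity_exponents; lia.
have W0 := @end_weight_neq0 R n n0.
have wq t : 0 <= t -> w n t = (alpha R n *: q0 + q2).[t].
  by move=> t0; rewrite wE uq0// uq2// mul1r hornerD hornerZ.
have cw : continuous (@w R n).
  rewrite (funext wE).
  by apply: continuousD_fun; exact: continuousZ_fun.
have wN (t : R) : w n (- t) = (-1) ^+ n.+1 * w n t.
  by rewrite !wE p0 p2; ring.
have ne2 : n%:R = (n - 2)%:R + 2 :> R by rewrite -natrD subnK//; lia.
(* On the exponents of S, the moments are constant, so pairing with a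
   residual only sees its coefficient at m and its value at 1. *)
have pair q K m q' : (forall c, c \in parity_exponents n ->
    integral01 (q * 'X^c) = K) -> supported (m :: parity_exponents n) q' ->
    q'`_m = -1 -> q'.[1] = 0 -> integral01 (q * q') = K - integral01 (q * 'X^m).
  move=> qK Sq' q'm q'1.
  have -> : q' = (q' + 'X^m) + (-1) *: 'X^m by rewrite scaleN1r addrK.
  rewrite mulrDr integral01D -scalerAr integral01Z mulN1r.
  rewrite (integral01_supported _ qK) ?hornerD ?hornerXn ?expr1n ?q'1 ?add0r
    ?mulr1//.
  move=> i iS; rewrite coefD coefXn; have [->|im] := eqVneq i m.
    by rewrite q'm addNr.
  by rewrite Sq' ?inE ?negb_or ?im// addr0.
have FS m q : (forall s, integral01 (q * 'X^s) =
      Z n m / W n - Z n m * Z n s * ((W n)^-1 + (s + m).+1%:R^-1)) ->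
    forall c, c \in parity_exponents n -> integral01 (q * 'X^c) = Z n m / W n.
  by move=> Fq c cS; rewrite Fq (@mellin_factor_eq0 R _ _ cS) mulr0 mul0r subr0.
exists (alpha R n *: q0 + q2), (Z n (n - 2)); split; split => //.
- rewrite (leq_trans (size_polyD _ _))// geq_max.
  rewrite (leq_trans (size_scale_leq _ _)).
    apply/leq_sizeP => j nj; apply: S2.
    by rewrite inE mem_parity_exponents; lia.
  apply/leq_sizeP => j nj; apply: S0.
  by rewrite inE mem_parity_exponents; lia.
- by rewrite hornerD hornerZ e0 e2 mulr0 addr0.
- move=> c cS; rewrite mulrDl integral01D integral01Zl.
  rewrite (FS _ _ F0 _ cS) (FS _ _ F2 _ cS) Ztop /alpha_ratio.
  by field.
- rewrite (inner_even cw cw); last first.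
    move=> t; rewrite !wN mulrACA -expr2 -exprM muln2 -signr_odd odd_double.
    by rewrite expr0 mul1r.
  rewrite (_ : \int[mu]_(t in `[0, 1]) _ =
    integral01 ((alpha R n *: q0 + q2) * (alpha R n *: q0 + q2))); last first.
    apply: eq_Rintegral => t; rewrite inE /= in_itv /= => /andP[t0 _].
    by rewrite wq// hornerM.
  have -> (a : R) : integral01 ((a *: q0 + q2) * (a *: q0 + q2)) =
      a ^+ 2 * integral01 (q0 * q0) + 2 * a * integral01 (q0 * q2)
      + integral01 (q2 * q2).
    have lin q' : integral01 ((a *: q0 + q2) * q') =
        a * integral01 (q0 * q') + integral01 (q2 * q').
      by rewrite mulrDl integral01D integral01Zl.
    by rewrite lin ![_ * (a *: q0 + q2)]mulrC !lin [q2 * q0]mulrC; ring.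
  (* In each pairing the constant moment cancels, leaving
     [Z(m) Z(m') (1 / W + 1 / (m + m' + 1))]. *)
  rewrite (pair _ _ _ _ (FS _ _ F0) S0 c0 e0).
  rewrite (pair _ _ _ _ (FS _ _ F0) S2 c2 e2).
  rewrite (pair _ _ _ _ (FS _ _ F2) S2 c2 e2) !F0 F2 Ztop.
  rewrite /gram_form /alpha_ratio.
  have -> : (n + n).+1%:R = 2 * n%:R + 1 :> R by rewrite -natr1 natrD; ring.
  have -> : (n - 2 + n).+1%:R = 2 * n%:R - 1 :> R.
    by rewrite -[_.+1%:R]natr1 natrD ne2; ring.
  have -> : (n - 2 + (n - 2)).+1%:R = 2 * n%:R - 3 :> R.
    by rewrite -[_.+1%:R]natr1 natrD ne2; ring.
  have : 3 <= n%:R :> R by rewrite ler_nat.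
  move: W0; move: (W n) (Z n (n - 2)) (n%:R) (alpha R n) => v z x a v0 x3.
  by field; rewrite v0 !gt_eqF//; lra.
Qed.

(** Each component of [q_l] pairs with [p] to a multiple of [p.[1]]. The total multiple is, up to
    sign, [1 / W n - 1 / W n.+1 - k z (b + 1) / W n], with [k] the coefficient of [w n] in [q_r]; it
    is zero by the choice of [alpha]. *)
Lemma q_l_orth n p : (3 <= n)%N -> (size p <= n.+1)%N -> p.[-1] = 0 ->
  inner (@q_l R n) (horner p) = 0.
Proof.
move=> n3 sp pN.
have n0 : (0 < n)%N by lia.
have [p1 [p2 [[S1 e1 F1] [S2 e2 F2 r0E]]]] := @r0_spec R n n0.
have [q [z [[z0 sq q1 Fq] [cw wN wq ww]]]] := w_spec n3.
pose b := alpha_ratio n.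
have sr0 : (size (p1 + p2)%R <= n.+1)%N.
  rewrite (leq_trans (size_polyD _ _))// geq_max (size_supported S2).
  by rewrite (leq_trans (size_supported S1)).
have r0E' : r0 n = horner (p1 + p2) by apply/funext.
(* Only [p1] has the parity of [w n]; its two endpoint values account for the factor 2. *)
have wr0 : inner (@w R n) (r0 n) = 2 * (z * (b + 1) / W n).
  rewrite r0E' (inner_parity cw wN wq Fq sr0) !hornerD e1 e2.
  rewrite (horner_supported_opp _ S1) (horner_supported_opp _ S2) e1 e2.
  by rewrite [(-1) ^+ n.+2]exprS /b; ring.
have W0 : 0 < W n by rewrite divr_gt0// ltr0n muln_gt0 n0.
have n3R : 3 <= n%:R :> R by rewrite ler_nat.
have G0 := gram_form_gt0 b n3R W0.
have ceq := alpha_ratio_eq n3; rewrite -/b in ceq.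
pose k := inner (@w R n) (r0 n) / inner (@w R n) (w n).
have kE : k * (z * (b + 1) / W n) = (W n)^-1 - (W n.+1)^-1.
  have -> : k * (z * (b + 1) / W n) =
      ((b + 1) / W n) ^+ 2 / gram_form n%:R (W n) b.
    by rewrite /k wr0 ww; field; rewrite ?z0 ?(gt_eqF W0) ?(gt_eqF G0).
  by rewrite -ceq mulrC mulrA mulVf ?mul1r// gt_eqF.
pose s : R := (-1) ^+ n.+1.
have qE : q_l n = fun t => 1 * (s * p1.[t] + - s * p2.[t]) + - (k * s) * w n t.
  apply/funext => t; rewrite /q_l /q_r -/k r0E hornerD wN -/s.
  rewrite (horner_supported_opp _ S1) (horner_supported_opp _ S2).
  by rewrite -/s [(-1) ^+ n.+2]exprS -/s; ring.
have cp1 := @continuous_horner R p1; have cp2 := @continuous_horner R p2.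
rewrite qE inner_linear//; last 2 first.
- by apply: continuousD_fun; exact: continuousZ_fun.
- exact: continuous_horner.
rewrite inner_linear//; last exact: continuous_horner.
rewrite (inner_endpoint S1 F1 sp) (inner_endpoint S2 F2 (leqW sp)).
rewrite (inner_parity cw wN wq Fq sp) pN !mulr0 !addr0.
transitivity (s * p.[1] * ((W n)^-1 - (W n.+1)^-1 - k * (z * (b + 1) / W n))).
  by rewrite /b; ring.
by rewrite kE subrr mulr0.
Qed.

End Orthogonality.

(** * Parity of the ultraspherical polynomials and of the profiles *)

Section Profiles.
Context {R : realType}.
Notation mu := (@lebesgue_measure R).
Implicit Types (f g h : R -> R) (p q : {poly R}) (m n N s c j k : nat) (t : R).

Lemma size_ultraspherical k : (size (ultraspherical (5 / 2 : R) k) <= k.+1)%N.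
Proof.
rewrite /ultraspherical; case: xgetP => [p _ [_ -> _]|_] //.
by rewrite size_poly0.
Qed.

(** The difference [d] of the two sides, up to reflection, has degree below [k] because the leading
    terms agree, and is orthogonal to all such polynomials, hence to itself. The default 0 satisfies
    the identity trivially. *)
Lemma ultraspherical_opp k t :
  (ultraspherical (5 / 2) k).[- t] = (-1) ^+ k * (ultraspherical (5 / 2) k).[t].
Proof.
rewrite /ultraspherical; case: xgetP => [p _ [_ sp orth]|_]; last first.
  by rewrite !horner0 mulr0.
pose pN := (-1) ^+ k *: (p \Po - 'X).
have pNE x : pN.[x] = (-1) ^+ k * p.[- x].
  by rewrite hornerZ horner_comp hornerN hornerX.
suff /(congr1 (horner^~ (- t))) : p - pN = 0.
  rewrite hornerD hornerN horner0 pNE opprK => /eqP.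
  by rewrite subr_eq0 => /eqP.
pose d := p - pN.
have sd : (size d <= k)%N.
  apply/leq_sizeP => j kj; rewrite coefD coefN coefZ coef_comp_polyN mulrA.
  have [->|jk] := eqVneq j k.
    by rewrite -exprD addnn -signr_odd odd_double mul1r subrr.
  by rewrite nth_default ?sp ?mulr0 ?subrr// ltn_neqAle eq_sym jk.
pose v : {poly R} := 1 - 'X ^+ 2.
have vE x : v.[x] = 1 - x ^+ 2 by rewrite /v !hornerE.
have {}orth q : (size q <= k)%N -> inner (horner p) (horner (q * v ^+ 2)) = 0.
  move=> sq; rewrite -[RHS](orth q sq); apply: eq_Rintegral => x.
  rewrite inE /= in_itv /= => /andP[x1 x2].
  (* For this parameter the weight on [[-1, 1]] is the polynomial [v ^+ 2]. *)
  have -> : 5 / 2 - 1 / 2 = 2%:R :> R by field.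
  have x3 : 0 <= 1 - x ^+ 2 by nra.
  by rewrite powR_mulrn// !hornerM vE; ring.
have orthN : inner (horner pN) (horner (d * v ^+ 2)) = 0.
  rewrite -[RHS](mulr0 ((-1) ^+ k)) -(orth (d \Po - 'X)); last first.
    by rewrite size_comp_poly2// size_polyN size_polyX.
  rewrite /inner -Rintegral_segmentZl; last first.
    by apply: continuousM_fun; exact: continuous_horner.
  rewrite !Rintegral_symmetric_segment//; last 2 first.
  - by apply: continuousZ_fun; apply: continuousM_fun; exact: continuous_horner.
  - by apply: continuousM_fun; exact: continuous_horner.
  apply: eq_Rintegral => x _.
  rewrite !pNE !hornerM !vE !horner_comp !hornerN !hornerX opprK.
  ring.
have dv : d * v = 0.
  apply: (@Rintegral_sqr_poly_eq0 _ _ (-1) 1); first lra.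
  rewrite -[RHS](_ : 1 * inner (horner p) (horner (d * v ^+ 2))
    + (-1) * inner (horner pN) (horner (d * v ^+ 2)) = 0); last first.
    by rewrite orth// orthN !mulr0 addr0.
  rewrite -inner_linear; [|exact: continuous_horner..].
  apply: eq_Rintegral => x _.
  by rewrite !hornerM /d hornerD hornerN; ring.
have v0 : v != 0.
  apply/eqP => /(congr1 (horner^~ 0)) /eqP.
  by rewrite vE horner0 expr0n subr0 oner_eq0.
by move/eqP: dv; rewrite mulf_eq0 (negPf v0) orbF => /eqP.
Qed.

(** In the vanishing integrals [q_r] is seen only on the left half, where it is a polynomial to
    which [q_l_orth] applies; [w] is turned into a polynomial there by its parity. *)
Lemma q_r_spec n : (3 <= n)%N -> exists p,
  [/\ (size p <= n.+1)%N, p.[-1] = 0, forall t, t <= 0 -> q_r n t = p.[t] &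
      continuous (@q_r R n)].
Proof.
move=> n3; have n0 : (0 < n)%N by lia.
have [p1 [p2 [[S1 e1 _] [S2 e2 _ r0E]]]] := @r0_spec R n n0.
have [q [z [[_ sq q1 _] [cw wN wq _]]]] := @w_spec R n n3.
pose k := inner (w n) (r0 n) / inner (w n) (@w R n).
have qE : q_r n = fun t => (p1 + p2).[t] + (- k) * w n t.
  by apply/funext => t; rewrite /q_r -/k r0E mulNr.
exists (p1 + p2 - (k * (-1) ^+ n.+1) *: (q \Po - 'X)); split.
- rewrite (leq_trans (size_polyD _ _))// geq_max size_polyN.
  rewrite (leq_trans (size_polyD _ _)) ?geq_max ?(size_supported S2)/=;
    last first.
    by rewrite (leq_trans (size_supported S1)).
  rewrite (leq_trans (size_scale_leq _ _))// size_comp_poly2//.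
  by rewrite size_polyN size_polyX.
- rewrite hornerD hornerN hornerZ horner_comp hornerN hornerX opprK q1 hornerD.
  rewrite (horner_supported_opp _ S1) (horner_supported_opp _ S2) e1 e2.
  by rewrite [(-1) ^+ n.+2]exprS; ring.
- move=> t t0; rewrite qE !hornerD hornerN hornerZ horner_comp hornerN hornerX.
  have -> : w n t = (-1) ^+ n.+1 * q.[- t].
    by rewrite -wq ?oppr_ge0// -wN opprK.
  ring.
- rewrite qE; apply: continuousD_fun; first exact: continuous_horner.
  exact: continuousZ_fun.
Qed.

(** Meant for [k >= 1]: [phit n k] is this function on [[-1, 1]] rescaled to [[0, 1)]. *)
Definition profile n k : R -> R := if k == 1%N then w n else phi0 k.

Definition profile_sign n k : nat := if k == 1%N then n.+1 else k.

Lemma profile_spec n k : (3 <= n)%N -> (1 <= k <= n)%N -> exists p,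
  [/\ (size p <= n.+1)%N, p.[-1] = 0, forall t, t <= 0 -> profile n k t = p.[t],
      continuous (profile n k) &
      forall t, profile n k (- t) = (-1) ^+ profile_sign n k * profile n k t].
Proof.
move=> n3 /andP[k1 kn]; rewrite /profile /profile_sign; case: eqVneq => [_|kn1].
  have [q [z [[_ sq q1 _] [cw wN wq _]]]] := @w_spec R n n3.
  exists ((-1) ^+ n.+1 *: (q \Po - 'X)); split => //.
  - rewrite (leq_trans (size_scale_leq _ _))// size_comp_poly2//.
    by rewrite size_polyN size_polyX.
  - by rewrite hornerZ horner_comp hornerN hornerX opprK q1 mulr0.
  - move=> t t0; rewrite hornerZ horner_comp hornerN hornerX.
    by rewrite -wq ?oppr_ge0// -wN opprK.
have k2 : (2 <= k)%N by lia.
pose v : {poly R} := 1 - 'X ^+ 2.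
pose U : {poly R} := ultraspherical (5 / 2) (k - 2).
have pE t : phi0 k t = (v * U).[t] by rewrite /phi0 hornerM /v !hornerE.
exists (v * U); split => //.
- rewrite (leq_trans (size_polyMleq _ _))//.
  have : (size v <= 3)%N.
    rewrite (leq_trans (size_polyD _ _))// geq_max size_poly1 size_polyN.
    by rewrite size_polyXn.
  have := @size_ultraspherical (k - 2); rewrite -/U; lia.
- by rewrite hornerM /v !hornerE sqrrN expr1n subrr mul0r.
- rewrite (_ : phi0 k = horner (v * U)); first exact: continuous_horner.
  exact/funext.
- move=> t; rewrite /phi0 ultraspherical_opp sqrrN mulrCA; congr (_ * _).
  by rewrite -[in RHS](subnK k2) exprD sqrrN expr1n mulr1.
Qed.

End Profiles.

(** * Symmetries of the scaling functions and the vanishing criterion *)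

Section ScalingFunctions.
Context {R : realType}.
Notation mu := (@lebesgue_measure R).
Implicit Types (f g h : R -> R) (p q : {poly R}) (m n N s c j k : nat) (t : R).

Lemma phitE n k t : (1 <= k)%N ->
  phit n k t = if (0 <= t) && (t < 1) then profile n k (2 * t - 1) else 0.
Proof. by case: k => [|[|k]]. Qed.

Lemma phit_out n k t : (1 <= k)%N -> (t < 0) || (1 <= t) -> phit n k t = 0.
Proof.
by move=> k1 tout; rewrite phitE// ifF//; apply/negP => /andP[]; lra.
Qed.

Lemma phit0_out n t : (t < -1) || (1 <= t) -> phit n 0 t = 0.
Proof. by move=> tout; rewrite /phit !ifF//; apply/negP => /andP[]; lra. Qed.

Lemma phit0_left n t : -1 <= t < 0 -> phit n 0 t = q_r n (2 * t + 1).
Proof. by move=> tin; rewrite /phit tin. Qed.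

Lemma phit0_right n t : 0 <= t < 1 -> phit n 0 t = q_l n (2 * t - 1).
Proof.
by move=> tin; rewrite /phit ifF ?tin//; apply/negP => /andP[]; lra.
Qed.

Lemma q_r_N1 n : (3 <= n)%N -> q_r n (-1) = 0 :> R.
Proof.
move=> n3; have [p [_ pN qp _]] := @q_r_spec R n n3.
by rewrite qp ?pN//; lra.
Qed.

(** The equality is pointwise although the support is cut half-open: at -1 and 1 it rests on
    [q_r n (-1) = 0]. *)
Lemma phit0_opp n t : (3 <= n)%N -> phit n 0 (- t) = phit n 0 t.
Proof.
move=> n3; have q0 := q_r_N1 n3.
suff H (s : R) : 0 <= s -> phit n 0 (- s) = phit n 0 s.
  have [t0|/ltW t0] := leP 0 t; first exact: H.
  by have := H (- t); rewrite opprK oppr_ge0 => ->.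
move=> s0; have [s1|s1] := leP 1 s.
  have [->|sn1] := eqVneq s 1; last first.
    by move: sn1; rewrite neq_lt => sn1; rewrite !phit0_out//; lra.
  rewrite phit0_left ?phit0_out; [|lra..].
  by rewrite -[RHS]q0; congr q_r; ring.
have [->|sn0] := eqVneq s 0; first by rewrite oppr0.
rewrite phit0_left ?phit0_right ?s0//; last by move: sn0; rewrite neq_lt; lra.
by congr (q_r n _); ring.
Qed.

(** Parity of the profile about the midpoint; at the ends 0 and 1 the half-open cut is harmless
    because the profile vanishes at -1. *)
Lemma phit_onem n k t : (3 <= n)%N -> (1 <= k <= n)%N ->
  phit n k (1 - t) = (-1) ^+ profile_sign n k * phit n k t.
Proof.
move=> n3 /[dup] k1n /andP[k1 kn].
have [p [_ pN profp _ profN]] := @profile_spec R n k n3 k1n.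
have prof0 : profile n k (-1) = 0 :> R by rewrite profp ?pN//; lra.
rewrite !phitE//.
have [->|t0] := eqVneq t 0.
  rewrite mulr0 sub0r prof0 if_same mulr0.
  by case: ifP => //; lra.
have [->|t1] := eqVneq t 1.
  rewrite subrr mulr0 sub0r prof0 if_same.
  by case: ifP => //; rewrite ?mulr0//; lra.
have -> : (0 <= 1 - t) && (1 - t < 1) = (0 <= t) && (t < 1).
  move: t0 t1; rewrite !neq_lt; lra.
case: ifP => _; last by rewrite mulr0.
by rewrite -profN; congr (profile n k _); ring.
Qed.

Lemma measurable_phit n k : (3 <= n)%N -> (k <= n)%N ->
  measurable_fun [set: R] (phit n k).
Proof.
move=> n3 kn.
have mitv (a b : R) : measurable_fun [set: R] (fun t => (a <= t) && (t < b)).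
  apply: measurable_and; first exact: measurable_fun_ler.
  exact: measurable_fun_ltr.
have maff f (a b : R) : continuous f ->
    measurable_fun [set: R] (fun t => f (a * t + b)).
  move=> cf; apply: (measurableT_comp (continuous_measurable_fun cf)).
  by apply: measurable_funD => //; apply: measurable_funM.
case: k kn => [_|k kn].
  have [p [_ _ _ cq]] := @q_r_spec R n n3.
  apply: measurable_fun_ifT; [exact: mitv|exact: maff|].
  apply: measurable_fun_ifT; [exact: mitv| |by []].
  by apply: maff; exact: continuous_oppr_comp.
have [p [_ _ _ cf _]] := @profile_spec R n k.+1 n3 kn.
rewrite (_ : phit n k.+1 = fun t =>
  if (0 <= t) && (t < 1) then profile n k.+1 (2 * t - 1) else 0); last first.
  by apply/funext => t; rewrite phitE.
by apply: measurable_fun_ifT; [exact: mitv|exact: maff|].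
Qed.

Lemma measurable_phitM n i k (a : R) : (3 <= n)%N -> (i <= n)%N -> (k <= n)%N ->
  measurable_fun [set: R] (fun t => phit n i t * phit n k (2 * t - a)).
Proof.
move=> n3 iN kN; apply: measurable_funM; first exact: measurable_phit.
apply: (measurableT_comp (measurable_phit n3 kN)).
by apply: measurable_funD => //; apply: measurable_funM.
Qed.

(* Used with y = 4 t + b: the products phit_i(t) phit_0(2 t - a) in question are
   supported where y lies in [-1, 1), and 2 t + 1 or 2 t - 1 is (y - 1) / 2. *)
Lemma Rintegral_q_l_refinement n (f : R -> R) (b : R) p : (3 <= n)%N ->
  (size p <= n.+1)%N -> p.[-1] = 0 ->
  (forall y, -1 <= y < 1 -> f ((y - b) / 4) = p.[(y - 1) / 2] * q_l n y) ->
  (forall y, (y < -1) || (1 <= y) -> f ((y - b) / 4) = 0) ->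
  \int[mu]_t f t = 0.
Proof.
move=> n3 sp pN fin fout.
have [r [_ _ _ cq]] := @q_r_spec R n n3.
have cql : continuous (@q_l R n) by exact: continuous_oppr_comp.
(* [P] is [p] in the variable [y]; the substitution fixes -1, so [P] still vanishes there. *)
pose P := p \Po (2^-1 *: ('X - 1%:P)).
have PE y : P.[y] = p.[(y - 1) / 2].
  by rewrite horner_comp hornerZ hornerXsubC mulrC.
have sP : (size P <= n.+1)%N.
  by rewrite size_comp_poly2// size_scale ?size_XsubC// invr_eq0 pnatr_eq0.
have PN : P.[-1] = 0 by rewrite PE -[RHS]pN; congr (p.[_]); field.
pose G := (fun y => q_l n y * P.[y]) \_ `[-1, 1].
have mG : measurable_fun [set: R] G.
  apply/(measurable_restrictT _ _).1 => //.
  apply: measurable_funTS; apply: continuous_measurable_fun.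
  by apply: continuousM_fun => //; exact: continuous_horner.
have fG t : f t = G (4 * t + b).
  rewrite -[in LHS](_ : (4 * t + b - b) / 4 = t); last by field.
  move: (4 * t + b) => y; rewrite /G patchE mem_setE in_itv /=.
  have [yin|yout] := boolP ((-1 <= y) && (y < 1)).
    rewrite fin// -PE mulrC; case: ifP => //; lra.
  (* [G] lives on the closed segment; the extra point [y = 1] contributes
     [q_l n 1 = q_r n (-1) = 0]. *)
  rewrite fout; last lra.
  case: ifP => // yin; have -> : y = 1 by lra.
  by rewrite /q_l q_r_N1// mul0r.
under eq_Rintegral do rewrite fG.
rewrite Rintegral_affine// /G -Rintegral_mkcond.
by rewrite [X in _ * X](q_l_orth n3 sP PN) mulr0.
Qed.

End ScalingFunctions.

(** * Refinement coefficients *)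

Section RefinementIntegrals.
Context {R : realType}.
Notation mu := (@lebesgue_measure R).
Implicit Types (n i k : nat) (a : R).

(** The numerators of the coefficients, with natural indices and a real shift, so that substitutions
    act directly on the arguments. *)
Definition refinement_integral n i k a : R :=
  \int[mu]_t (phit n i t * phit n k (2 * t - a)).

Lemma CmatE n (j : int) (i k : 'I_n.+1) :
  @Cmat R n j i k = refinement_integral n i k j%:~R
                    / \int[mu]_t (phit n k (2 * t) ^+ 2).
Proof. by rewrite !mxE. Qed.

(** Substitution of [- t], evenness of [phit n 0] and the reflection of [phit n k], since
    [a - 2 t = 1 - (2 t - (a - 1))]. *)
Lemma refinement_integral_tail n k a : (3 <= n)%N -> (1 <= k <= n)%N ->
  refinement_integral n 0 k (- a)
  = (-1) ^+ profile_sign n k * refinement_integral n 0 k (a - 1).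
Proof.
move=> n3 k1n; have kn : (k <= n)%N by case/andP: k1n.
rewrite /refinement_integral -Rintegral_signr -[RHS]Rintegral_opp; last first.
  apply: measurable_funM => //.
  exact: measurable_phitM.
apply: eq_Rintegral => t _; cbv beta; rewrite phit0_opp// mulrCA; congr (_ * _).
by rewrite -phit_onem//; congr phit; ring.
Qed.

Lemma refinement_integral_even n a : (3 <= n)%N ->
  refinement_integral n 0 0 (- a) = refinement_integral n 0 0 a.
Proof.
move=> n3; rewrite /refinement_integral -[RHS]Rintegral_opp; last first.
  exact: measurable_phitM.
apply: eq_Rintegral => t _; cbv beta; rewrite phit0_opp//; congr (_ * _).
by rewrite -[LHS]phit0_opp//; congr phit; ring.
Qed.

Lemma refinement_integral_onem n i k : (3 <= n)%N ->
  (1 <= i <= n)%N -> (1 <= k <= n)%N ->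
  refinement_integral n i k 1
  = (-1) ^+ (profile_sign n i + profile_sign n k) * refinement_integral n i k 0.
Proof.
move=> n3 i1n k1n.
have [i_n kn] : (i <= n)%N /\ (k <= n)%N by lia.
rewrite /refinement_integral -Rintegral_signr -[LHS]Rintegral_onem; last first.
  exact: measurable_phitM.
apply: eq_Rintegral => t _; cbv beta; rewrite phit_onem// exprD subr0.
have -> : 2 * (1 - t) - 1 = 1 - 2 * t by ring.
by rewrite phit_onem// mulrACA.
Qed.

(** For [t >= 0] the argument [2 t - a] is at least 1, beyond every support. *)
Lemma refinement_integral_disjoint n i k a : (1 <= i)%N -> a <= -1 ->
  refinement_integral n i k a = 0.
Proof.
move=> i1 a1; transitivity (\int[mu]_(t in setT) (0 : R)).
  apply: eq_Rintegral => t _.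
  have [t0|t0] := ltP t 0; first by rewrite phit_out ?t0 ?mul0r.
  case: k => [|k]; first by rewrite phit0_out ?mulr0//; lra.
  by rewrite [X in _ * X]phit_out ?mulr0//; lra.
by rewrite /Rintegral integral0.
Qed.

(** The supports overlap on [[-1, -1/2)], where the product is [q_r(2 t + 1) q_l(4 t + 3)]. *)
Lemma refinement_integral_left n : (3 <= n)%N ->
  refinement_integral n 0 0 (- 2) = 0.
Proof.
move=> n3; have [p [sp pN qp _]] := @q_r_spec R n n3.
apply: (@Rintegral_q_l_refinement R n _ 3 p) => // y yin; cbv beta.
  rewrite phit0_left; last lra.
  rewrite phit0_right; last lra.
  by rewrite -qp; [congr (q_r n _ * q_l n _); field|lra].
have [y1|y1] := ltP y (-1).
  have [y2|y2] := ltP ((y - 3) / 4) (-1); first by rewrite phit0_out ?y2 ?mul0r.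
  lra.
have [y2|y2] := leP 1 ((y - 3) / 4); first by rewrite phit0_out ?mul0r//; lra.
by rewrite [X in _ * X]phit0_out ?mulr0//; lra.
Qed.

(** The supports overlap on [[0, 1/2)], where the product is the profile at [2 t - 1] times
    [q_l(4 t - 1)]. *)
Lemma refinement_integral_right n i : (3 <= n)%N -> (1 <= i <= n)%N ->
  refinement_integral n i 0 0 = 0.
Proof.
move=> n3 i1n; have [i1 _] := andP i1n.
have [p [sp pN fp _ _]] := @profile_spec R n i n3 i1n.
apply: (@Rintegral_q_l_refinement R n _ (-1) p) => // y yin; cbv beta.
  rewrite phitE// ifT; last lra.
  rewrite phit0_right; last lra.
  by rewrite -fp; [congr (profile n i _ * q_l n _); field|lra].
have [y1|y1] := ltP y (-1).
  by rewrite phit_out ?mul0r//; lra.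
by rewrite phit0_out ?mulr0//; lra.
Qed.

End RefinementIntegrals.

Theorem theorem20 (R : realType) (n : nat) (hn : (3 <= n)%N) :
  let C (j : int) : 'M[R]_n.+1 := @Cmat R n j in
  (* C_{-2} *)
  [/\ (forall i k : 'I_n.+1, k = 0%N :> nat -> C (- 2) i k = 0),
      (forall i k : 'I_n.+1, i = 0%N :> nat -> k = 1%N :> nat ->
         C (- 2) i k = (-1) ^+ (n + 1) * C 1 i k),
      (forall i k : 'I_n.+1, i = 0%N :> nat -> (2 <= k)%N ->
         C (- 2) i k = (-1) ^+ k * C 1 i k)
    & (forall i k : 'I_n.+1, (1 <= i)%N -> (1 <= k)%N -> C (- 2) i k = 0)]
  /\
  (* C_{-1} *)
  [/\ (forall i k : 'I_n.+1, i = 0%N :> nat -> k = 0%N :> nat ->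
         C (- 1) i k = C 1 i k),
      (forall i k : 'I_n.+1, i = 0%N :> nat -> k = 1%N :> nat ->
         C (- 1) i k = (-1) ^+ (n + 1) * C 0 i k),
      (forall i k : 'I_n.+1, i = 0%N :> nat -> (2 <= k)%N ->
         C (- 1) i k = (-1) ^+ k * C 0 i k)
    & (forall i k : 'I_n.+1, (1 <= i)%N -> C (- 1) i k = 0)]
  /\
  (* C_0 *)
  (forall i k : 'I_n.+1, (1 <= i)%N -> k = 0%N :> nat -> C 0 i k = 0)
  /\
  (* C_1 *)
  [/\ (forall i k : 'I_n.+1, i = 1%N :> nat -> k = 1%N :> nat ->
         C 1 i k = C 0 i k),
      (forall i k : 'I_n.+1, i = 1%N :> nat -> (2 <= k)%N ->
         C 1 i k = (-1) ^+ (k + n + 1) * C 0 i k),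
      (forall i k : 'I_n.+1, (2 <= i)%N -> k = 1%N :> nat ->
         C 1 i k = (-1) ^+ (i + n + 1) * C 0 i k)
    & (forall i k : 'I_n.+1, (2 <= i)%N -> (2 <= k)%N ->
         C 1 i k = (-1) ^+ (i + k) * C 0 i k)].
Proof.
move=> C.
(* The normalising integral depends on [k] alone, so relations within a column pass from the
   numerators to [C]. *)
have div_eq (j j' : int) (i k : 'I_n.+1) (s : R) :
    refinement_integral n i k j%:~R = s * refinement_integral n i k j'%:~R ->
    C j i k = s * C j' i k.
  by move=> e; rewrite /C !CmatE e mulrA.
have div0 (j : int) (i k : 'I_n.+1) :
    refinement_integral n i k j%:~R = 0 :> R -> C j i k = 0.
  by move=> e; rewrite /C CmatE e mul0r.
have lt_n (i : 'I_n.+1) : (i <= n)%N by rewrite -ltnS ltn_ord.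
have sgn1 : profile_sign n 1 = (n + 1)%N by rewrite addn1.
have sgn k : (2 <= k)%N -> profile_sign n k = k by case: k => [|[|]].
(* The map from [j] to [- j - 1] exchanges -2 with 1 and -1 with 0. *)
have tail (i k : 'I_n.+1) (j j' : int) : (i = 0 :> nat)%N -> (1 <= k)%N ->
    j' = - j - 1 -> C j i k = (-1) ^+ profile_sign n k * C j' i k.
  move=> i0 k1 ->; apply: div_eq; rewrite i0 intrB intrN.
  by rewrite -refinement_integral_tail ?k1 ?lt_n// opprK.
have onem (i k : 'I_n.+1) : (1 <= i)%N -> (1 <= k)%N ->
    C 1 i k = (-1) ^+ (profile_sign n i + profile_sign n k) * C 0 i k.
  move=> i1 k1; apply: div_eq.
  by rewrite refinement_integral_onem ?i1 ?k1 ?lt_n.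
have disjoint (i k : 'I_n.+1) (j : int) : (1 <= i)%N -> j <= -1 -> C j i k = 0.
  move=> i1 j1; apply: div0; apply: refinement_integral_disjoint => //.
  by rewrite -[-1]/((-1)%:~R) ler_int.
split; [split|split; [split|split; [|split]]].
(* In column 0, rows [i >= 1] vanish by disjoint supports, row 0 by orthogonality. *)
- move=> i k k0; have [i1|] := leqP 1 i; first exact: disjoint.
  rewrite ltnS leqn0 => /eqP i0; apply: div0; rewrite i0 k0.
  exact: refinement_integral_left.
- by move=> i k i0 k1; rewrite (tail i k _ 1) ?k1 ?sgn1.
- by move=> i k i0 k2; rewrite (tail i k _ 1) ?sgn// ltnW.
- by move=> i k i1 _; exact: disjoint.
- move=> i k i0 k0; rewrite -[RHS]mul1r; apply: div_eq; rewrite i0 k0 mul1r.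
  by rewrite intrN refinement_integral_even.
- by move=> i k i0 k1; rewrite (tail i k _ 0) ?k1 ?sgn1.
- by move=> i k i0 k2; rewrite (tail i k _ 0) ?sgn// ltnW.
- by move=> i k i1; exact: disjoint.
- move=> i k i1 k0; apply: div0; rewrite k0 refinement_integral_right//.
  by rewrite i1 lt_n.
- move=> i k i1 k1; rewrite onem ?i1 ?k1// addnn -signr_odd odd_double.
  by rewrite expr0 mul1r.
- move=> i k i1 k2; rewrite onem ?i1 ?(ltnW k2)// sgn1 sgn//.
  by rewrite addnC addnA.
- move=> i k i2 k1; rewrite onem ?k1 ?(ltnW i2)// sgn1 sgn//.
  by rewrite addnA.
- by move=> i k i2 k2; rewrite onem ?(ltnW i2) ?(ltnW k2)// !sgn.
Qed.
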